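(* Let $S\in\mathbb N$, $T\in\mathbb N\cup\{\infty\}$ and let $\tau,\theta$ be finite stopping times such that $S\le\tau\le\theta\le T$. For a monetary utility functional process $(\phi_{t,T})_{t\in[S,T]\cap\mathbb N}$ with corresponding acceptance set process $(\mathcal C_{t,T})_{t\in[S,T]\cap\mathbb N}$ the following two conditions are equivalent: (1) $\phi_{\tau,T}(X)=\phi_{\tau,T}\big(X1_{[\tau,\theta)}+\phi_{\theta,T}(X)1_{[\theta,\infty)}\big)$ for all $X\in\mathcal R^\infty_{\tau,T}$. (2) $\mathcal C_{\tau,T}=\mathcal C_{\tau,\theta}+\mathcal C_{\theta,T}$.
   Context: Setup. $\mathbb N=\{0,1,2,\dots\}$; $(\Omega,\mathcal F,(\mathcal F_t)_{t\in\mathbb N},P)$ is a filtered probability space with $\mathcal F_0=\{\emptyset,\Omega\}$; stopping times are $(\mathcal F_t)$-stopping times. All equalities and inequalities between random variables or processes (for processes: simultaneously for all $t$) and all equalities and inclusions between events are understood $P$-almost surely. $\mathcal R^0$ is the space of real-valued adapted processes $(X_t)_{t\in\mathbb N}$ (a.s. equal processes are identified); $\mathcal R^\infty$ is the subspace of those with $\sup_{t}|X_t|\le m$ for some $m\in\mathbb R$. For stopping times $0\le\tau<\infty$, $\tau\le\theta\le\infty$, put $\pi_{\tau,\theta}(X)_t:=1_{\{\tau\le t\}}X_{t\wedge\theta}$ and $\mathcal R^\infty_{\tau,\theta}:=\pi_{\tau,\theta}\mathcal R^\infty$. $1_{[\tau,\infty)}$ and $1_{[\tau,\theta)}$ are the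 processes $t\mapsto1_{\{\tau\le t\}}$ and $t\mapsto1_{\{\tau\le t<\theta\}}$. Functionals. A monetary utility functional on $\mathcal R^\infty_{\tau,\theta}$ is a map $\phi:\mathcal R^\infty_{\tau,\theta}\to L^\infty(\mathcal F_\tau)$ with: (0) $\phi(1_AX)=1_A\phi(X)$ for all $X$ and $A\in\mathcal F_\tau$; (1) $\phi(X)\le\phi(Y)$ whenever $X\le Y$; (2) $\phi(X+m1_{[\tau,\infty)})=\phi(X)+m$ for all $X\in\mathcal R^\infty_{\tau,\theta}$, $m\in L^\infty(\mathcal F_\tau)$. For $X\in\mathcal R^\infty$ one sets $\phi(X):=\phi(\pi_{\tau,\theta}(X))$. The acceptance set is $\mathcal C_\phi:=\{X\in\mathcal R^\infty_{\tau,\theta}:\phi(X)\ge0\}$. Processes. For $S\le T$, a monetary utility functional process $(\phi_{t,T})_{t\in[S,T]\cap\mathbb N}$ consists of a monetary utility functional $\phi_{t,T}$ on $\mathcal R^\infty_{t,T}$ for each $t\in[S,T]\cap\mathbb N$; the acceptance sets $\mathcal C_{t,T}$ of $\phi_{t,T}$ form the corresponding acceptance set process. For stopping times $S\le\tau\le\theta\le T$ with $\tau<\infty$, define for $X\in\mathcal R^\infty_{\tau,\theta}$ $$\phi_{\tau,\theta}(X):=\sum_{t\in[S,T]\cap\mathbb N}\phi_{t,T}(1_{\{\tau=t\}}X),\qquad \mathcal C_{\tau,\theta}:=\{X\in\mathcal R^\infty_{\tau,\theta}:1_{\{\tau=t\}}X\in\mathcal C_{t,T}\ \text{for all }t\in[S,T]\cap\mathbb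 N\};$$ $\phi_{\tau,\theta}$ is a monetary utility functional on $\mathcal R^\infty_{\tau,\theta}$ with acceptance set $\mathcal C_{\tau,\theta}$. The sum of two sets of processes is the set of all pairwise sums. *)

(* Defs.v *)
From HB Require Import structures.
From mathcomp Require Import all_boot all_order all_algebra.
From mathcomp Require Import all_classical all_reals all_analysis.
Set Implicit Arguments.
Unset Strict Implicit.
Unset Printing Implicit Defensive.
Import Order.TTheory GRing.Theory Num.Theory.
Local Open Scope classical_set_scope.
Local Open Scope ring_scope.

(* [natinf] is N extended by infinity, which is represented by [None]. *)
Definition natinf : Type := option nat.

Definition le_natinf (a b : natinf) : bool :=
  match a, b with
  | _, None => true
  | None, Some _ => false
  | Some m, Some n => (m <= n)%N
  end.

Definition lt_natinf (a b : natinf) : bool := ~~ le_natinf b a.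

Definition min_nat_natinf (t : nat) (a : natinf) : nat :=
  if a is Some n then minn t n else t.

Section Functionals.
Context (d : measure_display) (Omega : measurableType d) (R : realType)
  (P : probability Omega R).

Implicit Types (F : nat -> set (set Omega)) (tau theta : Omega -> natinf).

Definition filtration F : Prop :=
  [/\ forall t, sigma_algebra [set: Omega] (F t),
      forall t, F t `<=` measurable &
      forall s t, (s <= t)%N -> F s `<=` F t].

Definition stopping_time F tau : Prop :=
  forall t, F t [set w | le_natinf (tau w) (Some t)].

Definition stopped_sigma_algebra F tau : set (set Omega) :=
  [set A | measurable A /\
    forall t, F t (A `&` [set w | le_natinf (tau w) (Some t)])].

Definition process : Type := nat -> Omega -> R.

Implicit Types (X Y Z : process).

(* Equality and order of processes hold simultaneously for all times. *)
Definition process_ae_eq X Y : Prop :=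
  \forall w \ae P, forall t, X t w = Y t w.

Definition process_ae_le X Y : Prop :=
  \forall w \ae P, forall t, X t w <= Y t w.

Definition measurable_wrt (G : set (set Omega)) (f : Omega -> R) : Prop :=
  forall B : set R, measurable B -> G (f @^-1` B).

(* Classes modulo almost sure equality are represented by their elements: the
   predicates below hold of every function that is almost surely equal to a
   measurable, resp. adapted, one.  The filtration is not assumed to be
   complete, so such a function need not itself be measurable, resp. adapted. *)
Definition Linfty (G : set (set Omega)) : set (Omega -> R) :=
  [set f | (exists2 g, measurable_wrt G g & f = g %[ae P]) /\
           exists m : R, \forall w \ae P, `|f w| <= m].

Definition R0 F : set process :=
  [set X | exists2 Y, (forall t, measurable_wrt (F t) (Y t)) &
                      process_ae_eq X Y].

Definition Rinfty F : set process :=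
  [set X | R0 F X /\
           exists m : R, \forall w \ae P, forall t, `|X t w| <= m].

Definition proj_between tau theta X : process := fun t w =>
  \1_[set v | le_natinf (tau v) (Some t)] w
    * X (min_nat_natinf t (theta w)) w.

Definition Rinfty_between F tau theta : set process :=
  [set X | exists2 Y, Rinfty F Y & process_ae_eq X (proj_between tau theta Y)].

Definition restrict_event (A : set Omega) X : process := fun t w =>
  \1_A w * X t w.

Definition from_time tau (m : Omega -> R) : process := fun t w =>
  m w * \1_[set v | le_natinf (tau v) (Some t)] w.

Definition before_time tau theta X : process := fun t w =>
  X t w * \1_[set v | le_natinf (tau v) (Some t)
                      && lt_natinf (Some t) (theta v)] w.

Definition add_process X Y : process := fun t w => X t w + Y t w.

(* Only the values of [phi] on [Rinfty_between F tau theta] matter;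
   monotonicity makes [phi] compatible with almost sure equality. *)
Record monetary_utility_functional F tau theta
    (phi : process -> Omega -> R) : Prop := {
  muf_Linfty : forall X, Rinfty_between F tau theta X ->
    Linfty (stopped_sigma_algebra F tau) (phi X);
  muf_local : forall X A, Rinfty_between F tau theta X ->
    stopped_sigma_algebra F tau A ->
    phi (restrict_event A X) = (fun w => \1_A w * phi X w) %[ae P];
  muf_monotone : forall X Y,
    Rinfty_between F tau theta X -> Rinfty_between F tau theta Y ->
    process_ae_le X Y -> \forall w \ae P, phi X w <= phi Y w;
  muf_translation : forall X m, Rinfty_between F tau theta X ->
    Linfty (stopped_sigma_algebra F tau) m ->
    phi (add_process X (from_time tau m)) = (fun w => phi X w + m w) %[ae P] }.

Definition acceptance_set F tau theta (phi : process -> Omega -> R) :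
    set process :=
  [set X | Rinfty_between F tau theta X /\ \forall w \ae P, 0 <= phi X w].

Definition muf_process F (S : nat) (T : natinf)
    (phi : nat -> process -> Omega -> R) : Prop :=
  forall t, (S <= t)%N -> le_natinf (Some t) T ->
    monetary_utility_functional F (fun=> Some t) (fun=> T) (phi t).

Definition acceptance_set_process F (T : natinf)
    (phi : nat -> process -> Omega -> R) (t : nat) : set process :=
  acceptance_set F (fun=> Some t) (fun=> T) (phi t).

Definition on_time tau (t : nat) X : process :=
  restrict_event [set w | tau w = Some t] X.

(* The functional phi_{tau,theta}; its formula depends on theta only through
   the domain.  If T is infinite this is a series whose terms almost surely
   vanish except for the one with t = tau. *)
Definition muf_at (S : nat) (T : natinf) (phi : nat -> process -> Omega -> R)
    tau X : Omega -> R := fun w =>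
  limn (fun n => \sum_(S <= t < n | le_natinf (Some t) T)
                   phi t (on_time tau t X) w).

Definition acceptance_set_at F (S : nat) (T : natinf)
    (C : nat -> set process) tau theta : set process :=
  [set X | Rinfty_between F tau theta X /\
    forall t, (S <= t)%N -> le_natinf (Some t) T -> C t (on_time tau t X)].

Definition sum_sets (A B : set process) : set process :=
  [set Z | exists X Y, [/\ A X, B Y & process_ae_eq Z (add_process X Y)]].

End Functionals.

(* Main.v *)
Require Import Defs.
From mathcomp Require Import all_boot all_order all_algebra.
From mathcomp Require Import all_classical all_reals all_analysis.
From mathcomp Require Import measurable_realfun zify.
Import Order.TTheory GRing.Theory Num.Theory.
Local Open Scope classical_set_scope.
Local Open Scope ring_scope.

(** Write V(X) for phi_{tau,T}(X), U(X) for phi_{theta,T} applied to the part of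
    X from theta on, and W(X) = X 1_[tau,theta) + U(X) 1_[theta,oo).  The first
    condition says that V(X) = V(W(X)).  Three observations carry the proof.
    - X = W(X) + D, where W(X) is stopped at theta, and
      D = (X - U(X)) 1_[theta,oo) is accepted at theta because U(D) = 0 by
      translation ([settled_remainder]).
    - If X = Y + Z, with Y stopped at theta and Z accepted at theta, then
      U(X) = Y_theta + U(Z) >= Y_theta, and therefore W(X) >= Y
      ([settled_ge]).
    - W commutes with shifts by m 1_[tau,oo) ([settled_translation]).

    Assume the first condition.  If X is accepted at tau, then
    V(W(X)) = V(X) >= 0 and the first observation decomposes X.  Conversely, if
    X = Y + Z with Y accepted at tau and stopped at theta, and Z accepted at
    theta, then V(X) = V(W(X)) >= V(Y) >= 0 by the second one.

    Assume the second condition.  The process X - V(X) 1_[tau,oo) is accepted,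
    hence is a sum Y + Z as above; by the last two observations
    W(X) - V(X) 1_[tau,oo) >= Y, so that V(W(X)) - V(X) >= V(Y) >= 0.  And
    X - V(W(X)) 1_[tau,oo) is the sum of W(X) - V(W(X)) 1_[tau,oo), accepted at
    tau and stopped at theta, and of D, accepted at theta; hence it is accepted
    at tau, that is, V(X) >= V(W(X)).

    Two reductions make this rigorous.  Membership in R^oo_{tau,theta} amounts
    to being bounded, adapted, zero before tau and stopped at theta, up to null
    sets ([Rinfty_betweenP]).  And the defining series of V(X) almost surely
    reduces to its term with t = tau ([muf_atE]), so that V inherits
    monotonicity and translation from the functionals phi_t, one event tau = t
    at a time ([ae_on_times]).  That a variable m is bounded and known at time
    tau is expressed by m 1_[tau,oo) being a bounded adapted process. *)

(** * Measurability with respect to a sub-sigma-algebra *)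

Lemma indic_bool {Omega : Type} {R : realType} (b : Omega -> bool) (w : Omega) :
  \1_[set v | b v] w = (b w)%:R :> R.
Proof.
by rewrite indicE; congr (nat_of_bool _)%:R; apply/idP/idP; rewrite inE.
Qed.

(** Measurability with respect to G is ordinary measurability on the space
    Omega equipped with the sigma-algebra G. *)
Lemma measurable_wrtP {d : measure_display} {Omega : measurableType d}
    {R : realType} {G : set (set Omega)} {f : Omega -> R} :
  sigma_algebra setT G ->
  measurable_wrt G f <-> measurable_fun (setT : set (g_sigma_algebraType G)) f.
Proof.
move=> sG; split=> [mf _ B mB|mf B mB].
  by rewrite setTI measurable_g_measurableTypeE//; exact: mf.
by have := mf measurableT B mB; rewrite setTI measurable_g_measurableTypeE.
Qed.

Section Sub_sigma_algebra.
Context {d : measure_display} {Omega : measurableType d} {R : realType}.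
Context {G : set (set Omega)}.
Context (sG : sigma_algebra [set: Omega] G).
Implicit Types (a b : Omega -> bool) (f g : Omega -> R).

Lemma event_not a : G [set w | a w] -> G [set w | ~~ a w].
Proof.
case: sG => _ GC _ /GC; rewrite setTD; congr G.
by apply/seteqP; split=> w /= /negP.
Qed.

Lemma event_and a b :
  G [set w | a w] -> G [set w | b w] -> G [set w | a w && b w].
Proof.
move=> Ga Gb; have -> : [set w | a w && b w] = [set w | a w] `&` [set w | b w].
  by apply/seteqP; split=> w /= => [/andP//|[-> ->]].
rewrite -(measurable_g_measurableTypeE sG).
by apply: measurableI; rewrite measurable_g_measurableTypeE.
Qed.

Lemma event_cst (c : bool) : G [set _ | c].
Proof.
case: sG => G0 GC _; case: c.
  by have := GC _ G0; rewrite setD0; congr G; apply/seteqP; split.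
by move: G0; congr G; apply/seteqP; split.
Qed.

Lemma measurable_wrt_add f g : measurable_wrt G f -> measurable_wrt G g ->
  measurable_wrt G (fun w => f w + g w).
Proof.
by move=> /(measurable_wrtP sG) mf /(measurable_wrtP sG) mg;
  apply/(measurable_wrtP sG); exact: measurable_funD.
Qed.

Lemma measurable_wrt_opp f : measurable_wrt G f ->
  measurable_wrt G (fun w => - f w).
Proof.
by move=> /(measurable_wrtP sG) mf; apply/(measurable_wrtP sG);
  exact: measurable_funN.
Qed.

Lemma measurable_wrt_cst (c : R) : measurable_wrt G (fun=> c).
Proof. by apply/(measurable_wrtP sG); exact: measurable_cst. Qed.

Lemma measurable_wrt_restrict b f : G [set w | b w] -> measurable_wrt G f ->
  measurable_wrt G (fun w => (b w)%:R * f w).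
Proof.
move=> Gb /(measurable_wrtP sG) mf; apply/(measurable_wrtP sG).
apply: measurable_funM => //.
under [X in measurable_fun _ X]eq_fun do rewrite -indic_bool.
by apply: measurable_indic; rewrite measurable_g_measurableTypeE.
Qed.

Lemma measurable_wrt_sum (n : nat) (h : nat -> Omega -> R) :
  (forall i, (i < n)%N -> measurable_wrt G (h i)) ->
  measurable_wrt G (fun w => \sum_(i < n) h i w).
Proof.
move=> mh; apply/(measurable_wrtP sG); apply: measurable_sum => i.
by apply/(measurable_wrtP sG); exact: mh.
Qed.

End Sub_sigma_algebra.

(** * Bounded adapted processes *)

Section Adapted.
Context {d : measure_display} {Omega : measurableType d} {R : realType}.
Context {P : probability Omega R} {F : nat -> set (set Omega)}.
Context (F_filtration : filtration F).
Implicit Types (X Y Z : process Omega R) (tau theta : Omega -> natinf).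

Let sF t : sigma_algebra [set: Omega] (F t).
Proof. by case: F_filtration. Qed.

Lemma stopping_time_eq tau s t : stopping_time F tau -> (s <= t)%N ->
  F t [set w | tau w == Some s].
Proof.
move=> tauS st; have [_ _ Fmono] := F_filtration; apply: (Fmono s t st).
case: s st => [|s] st.
  rewrite (_ : [set w | _] = [set w | le_natinf (tau w) (Some 0%N)]).
    exact: tauS.
  by apply/seteqP; split=> w /=; case: (tau w) => [[|n]|].
rewrite (_ : [set w | _] = [set w | le_natinf (tau w) (Some s.+1)
                                    && ~~ le_natinf (tau w) (Some s)]).
  apply: event_and => //.
  by apply: event_not => //; apply: (Fmono s) (tauS s).
apply/seteqP; split=> w /=; case: (tau w) => [n|] //=.
- by move=> /eqP[->]; rewrite leqnn -ltnNge ltnSn.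
- by rewrite -ltnNge => nn; apply/eqP; congr Some; lia.
Qed.

Lemma stopping_time_cst s : stopping_time F (fun=> Some s).
Proof. by move=> t /=; exact: event_cst. Qed.

Lemma Rinfty_ae_eq X Y : process_ae_eq P X Y -> Rinfty P F Y -> Rinfty P F X.
Proof.
move=> XY [[Z aZ YZ] [m mY]]; split.
  by exists Z => //; apply: filterS2 XY YZ => w XY YZ t; rewrite XY.
by exists m; apply: filterS2 XY mY => w XY mY t; rewrite XY.
Qed.

Lemma Rinfty_add X Y :
  Rinfty P F X -> Rinfty P F Y -> Rinfty P F (add_process X Y).
Proof.
move=> [[X' aX XX] [m mX]] [[Y' aY YY] [n nY]]; split.
  exists (add_process X' Y') => [t|]; first exact: measurable_wrt_add.
  by apply: filterS2 XX YY => w XX YY t; rewrite /add_process XX YY.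
exists (m + n); apply: filterS2 mX nY => w mX nY t.
by rewrite (le_trans (ler_normD _ _))// lerD.
Qed.

Lemma Rinfty_opp X : Rinfty P F X -> Rinfty P F (fun t w => - X t w).
Proof.
move=> [[X' aX XX] [m mX]]; split.
  exists (fun t w => - X' t w) => [t|]; first exact: measurable_wrt_opp.
  by apply: filterS XX => w XX t; rewrite XX.
by exists m; apply: filterS mX => w mX t; rewrite normrN.
Qed.

Lemma Rinfty_cst (c : R) : Rinfty P F (fun _ _ => c).
Proof.
split; last by exists `|c|; apply: aeW.
by exists (fun _ _ => c) => [t|]; [exact: measurable_wrt_cst|apply: aeW].
Qed.

Lemma Rinfty_restrict (b : nat -> Omega -> bool) X :
  (forall t, F t [set w | b t w]) -> Rinfty P F X ->
  Rinfty P F (fun t w => (b t w)%:R * X t w).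
Proof.
move=> Fb [[X' aX XX] [m mX]]; split.
  exists (fun t w => (b t w)%:R * X' t w) => [t|].
    exact: measurable_wrt_restrict.
  by apply: filterS XX => w XX t; rewrite XX.
exists m; apply: filterS mX => w mX t.
case: (b t w); rewrite ?mul1r ?mul0r ?normr0//.
by rewrite (le_trans _ (mX 0%N)).
Qed.

(** The sum over s <= t of 1_{tau = s} f s is f tau on tau <= t and zero
    elsewhere; this is how a process sampled at a stopping time is seen to be
    adapted. *)
Lemma sum_stopping_time tau t (f : nat -> R) w :
  \sum_(s < t.+1) (tau w == Some (s : nat))%:R * f s =
  if tau w is Some n then (n <= t)%N%:R * f n else 0.
Proof.
case: (tau w) => [n|]; last by rewrite big1// => s _; rewrite mul0r.
have [nt|tn] := leqP n t.
  rewrite (bigD1 (Ordinal (nt : (n < t.+1)%N)))//= eqxx big1 ?addr0// => s sn.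
  rewrite (_ : (_ == _) = false) ?mul0r//; apply: contra_neqF sn => /eqP[ns].
  by apply: val_inj.
rewrite mul0r big1// => s _; rewrite (_ : (_ == _) = false) ?mul0r//.
by apply/eqP => -[ns]; have := ltn_ord s; lia.
Qed.

Lemma Rinfty_stopped theta X : stopping_time F theta -> Rinfty P F X ->
  Rinfty P F (fun t w => X (min_nat_natinf t (theta w)) w).
Proof.
move=> thetaS [[X' aX XX] [m mX]]; split; last first.
  by exists m; apply: filterS mX => w mX t.
exists (fun t w => (~~ le_natinf (theta w) (Some t))%:R * X' t w +
   \sum_(s < t.+1) (theta w == Some (s : nat))%:R * X' s w) => [t|].
  apply: measurable_wrt_add => //.
    by apply: measurable_wrt_restrict => //; exact: event_not.
  apply: (measurable_wrt_sum _ _ (fun s w => (theta w == Some s)%:R * X' s w)).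
    by [].
  move=> s st; apply: measurable_wrt_restrict => //.
    exact: stopping_time_eq.
  by have [_ _ Fmono] := F_filtration => B mB; apply: (Fmono s t) (aX s B mB).
apply: filterS XX => w XX t; rewrite XX (sum_stopping_time theta t (X'^~ w)).
case: (theta w) => [n|] /=; last by rewrite mul1r addr0.
rewrite /minn; case: ltngtP => nt //=;
  by rewrite ?(mul1r, mul0r, addr0, add0r).
Qed.

(** A bounded variable that on each event theta = s agrees with an F s
    measurable one is known at time theta. *)
Lemma Rinfty_from_time theta (m : Omega -> R) (K : R) :
  stopping_time F theta ->
  (forall s, exists2 g, measurable_wrt (F s) g &
     \forall w \ae P, theta w = Some s -> m w = g w) ->
  (\forall w \ae P, `|m w| <= K) ->
  Rinfty P F (from_time theta m).
Proof.
move=> thetaS mE mK; split; last first.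
  exists K; apply: filterS mK => w mK t; rewrite /from_time indic_bool.
  by case: le_natinf; rewrite ?mulr1 ?mulr0 ?normr0 ?(le_trans _ mK).
have /boolp.choice[g /all_and2[ag gE]] : forall s, exists g,
    measurable_wrt (F s) g /\ \forall w \ae P, theta w = Some s -> m w = g w.
  by move=> s; have [g] := mE s; exists g.
exists (fun t w => \sum_(s < t.+1) (theta w == Some (s : nat))%:R * g s w).
  move=> t.
  apply: (measurable_wrt_sum _ _ (fun s w => (theta w == Some s)%:R * g s w)).
    by [].
  move=> s st; apply: measurable_wrt_restrict => //.
    exact: stopping_time_eq.
  by have [_ _ Fmono] := F_filtration => B mB; apply: (Fmono s t) (ag s B mB).
apply: filterS (ae_foralln gE) => w gEw t.
rewrite (sum_stopping_time theta t (g^~ w)) /from_time indic_bool.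
case E : (theta w) => [n|] /=; last by rewrite mulr0.
by rewrite (gEw n E) mulrC.
Qed.

(** * The spaces of processes between two stopping times *)

(** A process of the space R^oo_{tau,theta} is, up to null sets, a bounded
    adapted process that vanishes before tau and is stopped at theta. *)
Lemma Rinfty_betweenP tau theta X :
  stopping_time F tau -> stopping_time F theta ->
  (\forall w \ae P, le_natinf (tau w) (theta w)) ->
  Rinfty_between P F tau theta X <->
  Rinfty P F X /\ \forall w \ae P, forall t,
    (~~ le_natinf (tau w) (Some t) -> X t w = 0) /\
    X (min_nat_natinf t (theta w)) w = X t w.
Proof.
move=> tauS thetaS tt; split=> [[Y bY XY]|[bX sX]].
  split.
    apply: (Rinfty_ae_eq _ (fun t w => (le_natinf (tau w) (Some t))%:R *
               Y (min_nat_natinf t (theta w)) w)).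
      by apply: filterS XY => w XY t; rewrite XY /proj_between indic_bool.
    by apply: (Rinfty_restrict (fun t w => le_natinf (tau w) (Some t))) => //;
      exact: Rinfty_stopped.
  apply: filterS2 XY tt => w XY tt t; rewrite !XY /proj_between !indic_bool.
  split=> [/negbTE->|]; first by rewrite mul0r.
  case: (theta w) (tau w) tt => [n|] [k|] //= kn.
  by rewrite -minnA minnn; congr (_%:R * _); lia.
exists X => //; apply: filterS sX => w sX t; rewrite /proj_between indic_bool.
have [X0 ->] := sX t; case: le_natinf X0 => /= X0; first by rewrite mul1r.
by rewrite mul0r X0.
Qed.

Lemma Rinfty_between_ae_eq tau theta X Y : process_ae_eq P X Y ->
  Rinfty_between P F tau theta Y -> Rinfty_between P F tau theta X.
Proof.
move=> XY [Z bZ YZ]; exists Z => //.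
by apply: filterS2 XY YZ => w XY YZ t; rewrite XY.
Qed.

Lemma Rinfty_between_add tau theta X Y :
  Rinfty_between P F tau theta X -> Rinfty_between P F tau theta Y ->
  Rinfty_between P F tau theta (add_process X Y).
Proof.
move=> [X' bX XX] [Y' bY YY]; exists (add_process X' Y').
  exact: Rinfty_add.
by apply: filterS2 XX YY => w XX YY t; rewrite /add_process XX YY -mulrDr.
Qed.

Lemma Rinfty_between_from_time tau theta (m : Omega -> R) :
  (\forall w \ae P, le_natinf (tau w) (theta w)) ->
  Rinfty P F (from_time tau m) ->
  Rinfty_between P F tau theta (from_time tau m).
Proof.
move=> tt bm; exists (from_time tau m) => //.
apply: filterS tt => w tt t; rewrite /proj_between /from_time !indic_bool.
case: (tau w) (theta w) tt => [k|] [n|] //= kn; rewrite ?(mulr0, mul0r)//.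
  rewrite mulrCA -natrM mulnb leq_min kn andbT andbb //.
by rewrite mulrCA -natrM mulnb andbb.
Qed.

End Adapted.

(** * The functional of a process at a stopping time *)

Section Functional_at.
Context {d : measure_display} {Omega : measurableType d} {R : realType}.
Context {P : probability Omega R} {F : nat -> set (set Omega)}.
Context (F_filtration : filtration F).
Context {S : nat} {T : natinf} {phi : nat -> process Omega R -> Omega -> R}.
Context (phi_muf : muf_process P F S T phi).
Context {tau : Omega -> natinf}.
Context (tau_stopping : stopping_time F tau).
Context (tau_finite : \forall w \ae P, tau w <> None).
Context (S_le_tau : \forall w \ae P, le_natinf (Some S) (tau w)).
Context (tau_le_T : \forall w \ae P, le_natinf (tau w) T).
Implicit Types (X Y Z : process Omega R) (m : Omega -> R).

Local Notation V := (muf_at S T phi tau).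

Let sF t : sigma_algebra [set: Omega] (F t).
Proof. by case: F_filtration. Qed.

Let T_stopping : stopping_time F (fun=> T).
Proof. by move=> t /=; apply: event_cst. Qed.

(** A property holds almost surely as soon as it does so on each of the
    countably many events tau = t. *)
Lemma ae_on_times (Q : Omega -> Prop) :
  (forall t, (S <= t)%N -> le_natinf (Some t) T ->
     \forall w \ae P, tau w = Some t -> Q w) ->
  \forall w \ae P, Q w.
Proof.
move=> HQ; have : forall t, \forall w \ae P,
    (S <= t)%N -> le_natinf (Some t) T -> tau w = Some t -> Q w.
  move=> t; case: (boolP (S <= t)%N) => St; last exact: aeW.
  case: (boolP (le_natinf (Some t) T)) => tT; last exact: aeW.
  by apply: filterS (HQ t St tT) => w Hw _ _.
move=> /ae_foralln; apply: filterS3 (filterI tau_finite S_le_tau) tau_le_T.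
move=> w [fin St] tT Hw; case E : (tau w) fin => [t|]// _.
by rewrite E in St tT; exact: (Hw t St tT E).
Qed.

Lemma stopped_sigma_algebra_cst t (A : set Omega) :
  F t A -> stopped_sigma_algebra F (fun=> Some t) A.
Proof.
move=> FA; have [_ Fm Fmono] := F_filtration; split; first exact: (Fm t).
move=> s; have [ts|st] := leqP t s.
  rewrite (_ : [set _ | _] = setT) ?setIT; first exact: (Fmono t).
  by apply/seteqP; split.
rewrite (_ : [set _ | _] = set0) ?setI0; first by case: (sF s).
by apply/seteqP; split=> w //=; rewrite leqNgt st.
Qed.

Lemma stopped_sigma_algebra_cst_sub t :
  stopped_sigma_algebra F (fun=> Some t) `<=` F t.
Proof.
move=> A [_ /(_ t)] /=; rewrite leqnn.
by rewrite (_ : [set _ | _] = setT) ?setIT//; apply/seteqP; split.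
Qed.

Lemma on_timeE t X s w :
  on_time tau t X s w = (tau w == Some t)%:R * X s w.
Proof.
rewrite /on_time /restrict_event (_ : [set w | _] = [set w | tau w == Some t]).
  by rewrite indic_bool.
by apply/seteqP; split=> v /= => /eqP.
Qed.

Lemma Rinfty_on_time t X : le_natinf (Some t) T ->
  Rinfty_between P F tau (fun=> T) X ->
  Rinfty_between P F (fun=> Some t) (fun=> T) (on_time tau t X).
Proof.
move=> tT.
move=> /(Rinfty_betweenP F_filtration _ _ _ tau_stopping T_stopping tau_le_T).
move=> [bX sX]; apply/(Rinfty_betweenP F_filtration).
- exact: stopping_time_cst.
- exact: T_stopping.
- exact: aeW.
split; last first.
  apply: filterS sX => w sX s; rewrite !on_timeE.
  have [X0 XT] := sX s; rewrite XT; split=> // ts.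
  by have [tauE|_] := eqVneq; rewrite ?mul0r// X0 ?mulr0// tauE.
apply: (Rinfty_ae_eq _ (fun s w =>
    ((t <= s)%N && (tau w == Some t))%:R * X s w)); last first.
  apply: (Rinfty_restrict F_filtration
    (fun s w => (t <= s)%N && (tau w == Some t))) => // s.
  case: leqP => ts /=; last exact: (event_cst (sF s) false).
  exact: (stopping_time_eq F_filtration).
apply: filterS sX => w sX s; rewrite on_timeE.
case: leqP => //= st; rewrite mul0r; have [tauE|_] := eqVneq; rewrite ?mul0r//.
by rewrite (sX s).1 ?mulr0// tauE /= -ltnNge.
Qed.

(** By locality phi_t(1_{tau = t} X) vanishes off tau = t. *)
Lemma muf_on_time_local t X : (S <= t)%N -> le_natinf (Some t) T ->
  Rinfty_between P F tau (fun=> T) X ->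
  \forall w \ae P, tau w <> Some t -> phi t (on_time tau t X) w = 0.
Proof.
move=> St tT bX.
have FA : stopped_sigma_algebra F (fun=> Some t) [set w | tau w == Some t].
  apply: stopped_sigma_algebra_cst.
  exact: (stopping_time_eq F_filtration).
have := muf_local (phi_muf t St tT) (Rinfty_on_time t X tT bX) FA.
have -> : restrict_event [set w | tau w == Some t] (on_time tau t X) =
          on_time tau t X.
  apply/funext => s; apply/funext => w.
  rewrite /restrict_event indic_bool on_timeE.
  by case: (tau w == Some t); rewrite ?mul1r ?mul0r.
apply: filterS => w /(_ I) -> /eqP/negbTE tn.
by rewrite indic_bool tn mul0r.
Qed.

(** The defining series reduces to its term with t = tau. *)
Lemma muf_atE X : Rinfty_between P F tau (fun=> T) X ->
  \forall w \ae P, forall t, tau w = Some t ->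
    V X w = phi t (on_time tau t X) w.
Proof.
move=> bX; have loc : forall t, \forall w \ae P,
    (S <= t)%N -> le_natinf (Some t) T -> tau w <> Some t ->
    phi t (on_time tau t X) w = 0.
  move=> t; case: (boolP (S <= t)%N) => St; last exact: aeW.
  case: (boolP (le_natinf (Some t) T)) => tT; last exact: aeW.
  by apply: filterS (muf_on_time_local t X St tT bX) => w loc _ _.
move: loc => /ae_foralln.
apply: filterS3 (filterI tau_finite S_le_tau) tau_le_T.
move=> w [fin St] tT loc t tauE; rewrite tauE in St tT.
rewrite /muf_at; apply: (@lim_near_cst R^o) => //.
exists t.+1 => // n tn; have {}tn : (t < n)%N by [].
have {}St : (S <= t)%N by [].
rewrite big_mkcond (bigD1_seq t) ?iota_uniq ?mem_index_iota ?St//.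
rewrite tT big1_seq; first exact: addr0.
move=> s /andP[st]; rewrite mem_index_iota => /andP[Ss _].
case: ifP => // sT; apply: loc => //; rewrite tauE => -[ts].
by rewrite ts eqxx in st.
Qed.

Lemma muf_at_monotone X Y :
  Rinfty_between P F tau (fun=> T) X -> Rinfty_between P F tau (fun=> T) Y ->
  process_ae_le P X Y -> \forall w \ae P, V X w <= V Y w.
Proof.
move=> bX bY XY; apply: ae_on_times => t St tT.
have := muf_monotone (phi_muf t St tT) (Rinfty_on_time t X tT bX)
  (Rinfty_on_time t Y tT bY).
have leXY : process_ae_le P (on_time tau t X) (on_time tau t Y).
  apply: filterS XY => w XY s; rewrite !on_timeE.
  by rewrite ler_wpM2l// ler0n.
move=> /(_ leXY); apply: filterS3 (muf_atE X bX) (muf_atE Y bY).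
by move=> w VX VY le tauE; rewrite (VX t)// (VY t).
Qed.

Lemma muf_at_ae_eq X Y : process_ae_eq P X Y ->
  Rinfty_between P F tau (fun=> T) Y -> \forall w \ae P, V X w = V Y w.
Proof.
move=> XY bY; have bX := Rinfty_between_ae_eq _ _ _ _ XY bY.
have leXY : process_ae_le P X Y by apply: filterS XY => w XY t; rewrite XY.
have leYX : process_ae_le P Y X by apply: filterS XY => w XY t; rewrite XY.
apply: filterS2 (muf_at_monotone _ _ bX bY leXY)
  (muf_at_monotone _ _ bY bX leYX).
by move=> w le1 le2; apply/eqP; rewrite eq_le le1.
Qed.

(** The admissible shifts m are those for which m 1_[tau,oo) is a bounded
    adapted process. *)
Lemma muf_at_translation X m : Rinfty_between P F tau (fun=> T) X ->
  Rinfty P F (from_time tau m) ->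
  \forall w \ae P, V (add_process X (from_time tau m)) w = V X w + m w.
Proof.
move=> bX bm; have bXm : Rinfty_between P F tau (fun=> T)
    (add_process X (from_time tau m)).
  by apply: Rinfty_between_add => //; apply: Rinfty_between_from_time.
apply: ae_on_times => t St tT.
have [[Y aY mY] [K mK]] := bm.
have Lm : Linfty P (stopped_sigma_algebra F (fun=> Some t))
    (fun w => (tau w == Some t)%:R * m w).
  split.
    exists (fun w => (tau w == Some t)%:R * Y t w).
      move=> B mB; apply: stopped_sigma_algebra_cst; move: B mB.
      apply: measurable_wrt_restrict => //.
      exact: (stopping_time_eq F_filtration).
    apply: filterS mY => w mY _; rewrite -mY /from_time indic_bool.
    by have [->|] := eqVneq; rewrite ?mul0r//= leqnn mulr1.
  exists K; apply: filterS mK => w /(_ t); rewrite /from_time indic_bool.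
  have [->|_] := eqVneq; first by rewrite /= leqnn mulr1 mul1r.
  by rewrite mul0r normr0; apply: le_trans.
have := muf_translation (phi_muf t St tT) (Rinfty_on_time t X tT bX) Lm.
have -> : add_process (on_time tau t X)
    (from_time (fun=> Some t) (fun w => (tau w == Some t)%:R * m w)) =
    on_time tau t (add_process X (from_time tau m)).
  apply/funext => s; apply/funext => w.
  rewrite /add_process /from_time !on_timeE !indic_bool.
  by have [->|_] := eqVneq; rewrite ?mul0r ?addr0// !mul1r.
apply: filterS3 (muf_atE X bX) (muf_atE _ bXm) => w VX VXm /(_ I) tr tauE.
by rewrite (VX t)// (VXm t)// tr tauE eqxx mul1r.
Qed.

(** The value phi_tau(X) is known at time tau and bounded: it is measurable on
    each event tau = t, and phi_t(X) lies between -K and K when X does. *)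
Lemma Rinfty_muf_at X : Rinfty_between P F tau (fun=> T) X ->
  Rinfty P F (from_time tau (V X)).
Proof.
move=> bX.
have [[bX' [K mK]] sX] :=
  (Rinfty_betweenP F_filtration _ _ _ tau_stopping T_stopping tau_le_T).1 bX.
have bc (c : R) : Rinfty P F (from_time tau (fun=> c)).
  apply: (Rinfty_from_time F_filtration tau _ `|c|) => // [s|]; last exact: aeW.
  by exists (fun=> c); [exact: measurable_wrt_cst|exact: aeW].
pose Z : process Omega R := fun _ _ => 0.
have bZ : Rinfty_between P F tau (fun=> T) Z.
  exists Z; first exact: Rinfty_cst.
  by apply: aeW => w t; rewrite /proj_between mulr0.
have V0 : \forall w \ae P, V Z w = 0.
  (* Locality for the empty event. *)
  apply: ae_on_times => t St tT.
  have F0 : stopped_sigma_algebra F (fun=> Some t) set0.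
    by apply: stopped_sigma_algebra_cst; case: (sF t).
  have := muf_local (phi_muf t St tT) (Rinfty_on_time t Z tT bZ) F0.
  have -> : restrict_event set0 (on_time tau t Z) = on_time tau t Z.
    apply/funext => s; apply/funext => w.
    by rewrite /restrict_event on_timeE /Z !mulr0.
  apply: filterS2 (muf_atE Z bZ) => w VZ /(_ I) + tauE.
  by rewrite (VZ t)// indic0 mul0r.
have Vc (c : R) : \forall w \ae P,
    V (add_process Z (from_time tau (fun=> c))) w = c.
  apply: filterS2 V0 (muf_at_translation Z (fun=> c) bZ (bc c)) => w V0 ->.
  by rewrite V0 add0r.
have bZc (c : R) : Rinfty_between P F tau (fun=> T)
    (add_process Z (from_time tau (fun=> c))).
  by apply: Rinfty_between_add => //; apply: Rinfty_between_from_time.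
have leK : process_ae_le P X (add_process Z (from_time tau (fun=> K))).
  apply: filterS2 mK sX => w mK sX t.
  rewrite /add_process /Z /from_time add0r indic_bool.
  case: (boolP (le_natinf _ _)) => [_|/(sX t).1 ->]; last by rewrite mulr0.
  by rewrite mulr1 (le_trans (ler_norm _)).
have geK : process_ae_le P (add_process Z (from_time tau (fun=> - K))) X.
  apply: filterS2 mK sX => w mK sX t.
  rewrite /add_process /Z /from_time add0r indic_bool.
  case: (boolP (le_natinf _ _)) => [_|/(sX t).1 ->]; last by rewrite mulr0.
  by rewrite mulr1 lerNl (le_trans (ler_norm _))// normrN.
apply: (Rinfty_from_time F_filtration tau _ K) => // [s|].
  case: (boolP ((S <= s)%N && le_natinf (Some s) T)) => [/andP[Ss sT]|nsT].
    have [[g mg gE] _] :=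
      muf_Linfty (phi_muf s Ss sT) (Rinfty_on_time s X sT bX).
    exists g => [B mB|].
      by apply: stopped_sigma_algebra_cst_sub; exact: mg.
    apply: filterS2 (muf_atE X bX) gE => w VX gE tauE.
    by rewrite (VX s)// gE.
  exists (fun=> 0); first exact: measurable_wrt_cst.
  apply: filterS2 S_le_tau tau_le_T => w Sw wT tauE.
  by rewrite tauE in Sw wT; move: nsT; rewrite [(S <= s)%N]Sw wT.
have := muf_at_monotone _ _ bX (bZc K) leK.
have := muf_at_monotone _ _ (bZc (- K)) bX geK.
apply: filterS3 (filterI (Vc K) (Vc (- K))) => w [-> ->] Kle leK'.
by rewrite ler_norml Kle.
Qed.

(** The acceptance set of phi_{tau,theta}, defined event by event, consists of
    the processes of its domain with nonnegative value. *)
Lemma acceptance_set_atP (theta : Omega -> natinf) X :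
  Rinfty_between P F tau theta `<=` Rinfty_between P F tau (fun=> T) ->
  acceptance_set_at P F S T (acceptance_set_process P F T phi) tau theta X <->
  Rinfty_between P F tau theta X /\ \forall w \ae P, 0 <= V X w.
Proof.
move=> sub; split=> [[bX aX]|[bX V0]]; split=> //.
  apply: ae_on_times => t St tT; have [_] := aX t St tT.
  apply: filterS2 (muf_atE X (sub _ bX)) => w VX p0 tauE.
  by rewrite (VX t).
move=> t St tT; have bXt := Rinfty_on_time t X tT (sub _ bX); split=> //.
(* Off tau = t the value is nonnegative because it vanishes there. *)
have := muf_on_time_local t X St tT (sub _ bX).
apply: filterS3 V0 (muf_atE X (sub _ bX)) => w V0 VX loc.
by have [tauE|/eqP/loc ->//] := eqVneq (tau w) (Some t); rewrite -(VX t).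
Qed.

End Functional_at.

(** * The decomposition at an intermediate stopping time *)

(** The process X 1_[tau,theta) + phi_{theta,T}(X) 1_[theta,oo): from theta
    onwards X is replaced by the constant phi_{theta,T}(X). *)
Definition settled {d : measure_display} {Omega : measurableType d}
    {R : realType} (S : nat) (T : natinf)
    (phi : nat -> process Omega R -> Omega -> R) (tau theta : Omega -> natinf)
    (X : process Omega R) : process Omega R :=
  add_process (before_time tau theta X)
    (from_time theta (muf_at S T phi theta (proj_between theta (fun=> T) X))).

Section Decomposition.
Context {d : measure_display} {Omega : measurableType d} {R : realType}.
Context {P : probability Omega R} {F : nat -> set (set Omega)}.
Context (F_filtration : filtration F).
Context {S : nat} {T : natinf} {phi : nat -> process Omega R -> Omega -> R}.
Context (phi_muf : muf_process P F S T phi).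
Context {tau theta : Omega -> natinf}.
Context (tau_stopping : stopping_time F tau).
Context (theta_stopping : stopping_time F theta).
Context (tau_finite : \forall w \ae P, tau w <> None).
Context (theta_finite : \forall w \ae P, theta w <> None).
Context (S_le_tau : \forall w \ae P, le_natinf (Some S) (tau w)).
Context (tau_le_theta : \forall w \ae P, le_natinf (tau w) (theta w)).
Context (theta_le_T : \forall w \ae P, le_natinf (theta w) T).
Implicit Types (X Y Z : process Omega R) (m : Omega -> R).

Local Notation V := (muf_at S T phi tau).
Local Notation U X := (muf_at S T phi theta (proj_between theta (fun=> T) X)).
Local Notation C := (acceptance_set_process P F T phi).
Local Notation Ctau_T := (acceptance_set_at P F S T C tau (fun=> T)).
Local Notation Ctau_theta := (acceptance_set_at P F S T C tau theta).
Local Notation Ctheta_T := (acceptance_set_at P F S T C theta (fun=> T)).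
Local Notation W := (settled S T phi tau theta).

Let sF t : sigma_algebra [set: Omega] (F t).
Proof. by case: F_filtration. Qed.

Let T_stopping : stopping_time F (fun=> T).
Proof. by move=> t /=; apply: event_cst. Qed.

Let tau_le_T : \forall w \ae P, le_natinf (tau w) T.
Proof.
apply: filterS2 tau_le_theta theta_le_T => w.
by case: (tau w) (theta w) T => [i|] [j|] [k|] //=; exact: leq_trans.
Qed.

Let S_le_theta : \forall w \ae P, le_natinf (Some S) (theta w).
Proof.
apply: filterS2 S_le_tau tau_le_theta => w.
by case: (tau w) (theta w) => [i|] [j|] //=; exact: leq_trans.
Qed.

Let RP_tau_T X := Rinfty_betweenP F_filtration tau (fun=> T) X
  tau_stopping T_stopping tau_le_T.
Let RP_theta_T X := Rinfty_betweenP F_filtration theta (fun=> T) X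
  theta_stopping T_stopping theta_le_T.
Let RP_tau_theta X := Rinfty_betweenP F_filtration tau theta X
  tau_stopping theta_stopping tau_le_theta.

Lemma Rinfty_between_widen_end :
  Rinfty_between P F tau theta `<=` Rinfty_between P F tau (fun=> T).
Proof.
move=> X /RP_tau_theta[bX sX]; apply/RP_tau_T; split=> //.
apply: filterS2 theta_le_T sX => w thT sX t; split; first by case: (sX t).
rewrite -(sX t).2 -(sX (min_nat_natinf t T)).2; congr (X _ w).
by case: (theta w) T thT => [n|] [k|] //= nk; lia.
Qed.

Lemma Rinfty_between_widen_start :
  Rinfty_between P F theta (fun=> T) `<=` Rinfty_between P F tau (fun=> T).
Proof.
move=> X /RP_theta_T[bX sX]; apply/RP_tau_T; split=> //.
apply: filterS2 tau_le_theta sX => w tt sX t; have [X0 XT] := sX t.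
split=> // tt'; apply: X0; move: tt tt'.
by case: (tau w) (theta w) => [i|] [j|] //=; lia.
Qed.

Let acc_tau_T X : Ctau_T X <->
  Rinfty_between P F tau (fun=> T) X /\ \forall w \ae P, 0 <= V X w.
Proof.
by apply: (acceptance_set_atP F_filtration phi_muf tau_stopping tau_finite
  S_le_tau tau_le_T).
Qed.

Let acc_tau_theta X : Ctau_theta X <->
  Rinfty_between P F tau theta X /\ \forall w \ae P, 0 <= V X w.
Proof.
apply: (acceptance_set_atP F_filtration phi_muf tau_stopping tau_finite
  S_le_tau tau_le_T).
exact: Rinfty_between_widen_end.
Qed.

Let acc_theta_T X : Ctheta_T X <->
  Rinfty_between P F theta (fun=> T) X /\
  \forall w \ae P, 0 <= muf_at S T phi theta X w.
Proof.
by apply: (acceptance_set_atP F_filtration phi_muf theta_stopping theta_finite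
  S_le_theta theta_le_T).
Qed.

Let V_monotone := muf_at_monotone F_filtration phi_muf tau_stopping tau_finite
  S_le_tau tau_le_T.
Let V_ae_eq := muf_at_ae_eq F_filtration phi_muf tau_stopping tau_finite
  S_le_tau tau_le_T.
Let V_translation := muf_at_translation F_filtration phi_muf tau_stopping
  tau_finite S_le_tau tau_le_T.
Let V_Rinfty := Rinfty_muf_at F_filtration phi_muf tau_stopping tau_finite
  S_le_tau tau_le_T.
Let U_ae_eq := muf_at_ae_eq F_filtration phi_muf theta_stopping theta_finite
  S_le_theta theta_le_T.
Let U_translation := muf_at_translation F_filtration phi_muf theta_stopping
  theta_finite S_le_theta theta_le_T.
Let U_Rinfty := Rinfty_muf_at F_filtration phi_muf theta_stopping theta_finite
  S_le_theta theta_le_T.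

Let Rinfty_tau_T X : Rinfty_between P F tau (fun=> T) X -> Rinfty P F X.
Proof. by case/RP_tau_T. Qed.

Lemma Rinfty_between_proj X : Rinfty P F X ->
  Rinfty_between P F theta (fun=> T) (proj_between theta (fun=> T) X).
Proof. by move=> bX; exists X => //; apply: aeW. Qed.

Lemma from_time_opp (sigma : Omega -> natinf) m :
  from_time sigma (fun w => - m w) = (fun t w => - from_time sigma m t w).
Proof.
by apply/funext => t; apply/funext => w; rewrite /from_time mulNr.
Qed.

Lemma Rinfty_between_settled X : Rinfty_between P F tau (fun=> T) X ->
  Rinfty_between P F tau theta (W X).
Proof.
move=> bX; apply/RP_tau_theta; split.
  apply: Rinfty_add => //; last first.
    by apply/U_Rinfty/Rinfty_between_proj/Rinfty_tau_T.
  apply: (Rinfty_ae_eq _ (fun t w => (le_natinf (tau w) (Some t)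
      && lt_natinf (Some t) (theta w))%:R * X t w)).
    by apply: aeW => w t; rewrite /before_time indic_bool mulrC.
  apply: (Rinfty_restrict F_filtration (fun t w => le_natinf (tau w) (Some t)
      && lt_natinf (Some t) (theta w))); last exact: Rinfty_tau_T.
  move=> t; apply: event_and => //.
  by apply: event_not.
apply: filterS tau_le_theta => w tt t.
rewrite /settled /add_process /before_time /from_time !indic_bool /lt_natinf.
split=> [/negbTE tt'|].
  rewrite tt' mulr0 add0r (_ : le_natinf _ _ = false) ?mulr0//.
  move: tt tt'; case: (tau w) (theta w) => [i|] [j|] //=; lia.
case: (theta w) tt => [n|]//= tt; have [nt|tn] := leqP n t.
  by rewrite leqnn /= !andbF !mulr0.
by rewrite leqNgt tn.
Qed.

(** The remainder is D = (X - phi_theta(X)) 1_[theta,oo), and phi_theta(D) is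
    zero. *)
Lemma settled_remainder X : Rinfty_between P F tau (fun=> T) X ->
  exists2 D, Ctheta_T D & process_ae_eq P X (add_process (W X) D).
Proof.
move=> bX; have bpX := Rinfty_between_proj X (Rinfty_tau_T X bX).
have bU : Rinfty P F (from_time theta (fun w => - U X w)).
  by rewrite from_time_opp; apply: Rinfty_opp => //; exact: U_Rinfty.
exists (add_process (proj_between theta (fun=> T) X)
    (from_time theta (fun w => - U X w))).
  apply/acc_theta_T; split.
    by apply: Rinfty_between_add => //; apply: Rinfty_between_from_time.
  by apply: filterS (U_translation _ _ bpX bU) => w ->; rewrite subrr.
have [_ sX] := (RP_tau_T X).1 bX.
apply: filterS2 tau_le_theta sX => w tt sX t; have [X0 XT] := sX t.
rewrite /settled /add_process /before_time /from_time /proj_between !indic_bool.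
rewrite XT /lt_natinf mulNr.
case: (boolP (le_natinf (theta w) (Some t))) => /= tht.
  by rewrite andbF mulr0 add0r !mulr1 mul1r addrC subrK.
rewrite andbT !mulr0 mul0r !addr0 subr0.
by case: (boolP (le_natinf (tau w) _)) X0 => /= _ X0;
  rewrite ?mulr1 ?mulr0 addr0// X0.
Qed.

(** If X = Y + Z with Y stopped at theta and Z accepted at theta, then
    phi_theta(X) = Y_theta + phi_theta(Z) is at least Y_theta. *)
Lemma settled_ge X Y Z : Rinfty_between P F tau theta Y -> Ctheta_T Z ->
  process_ae_eq P X (add_process Y Z) -> process_ae_le P Y (W X).
Proof.
move=> bY /acc_theta_T[bZ Z0] XYZ.
have [bY' sY] := (RP_tau_theta Y).1 bY; have [_ sZ] := (RP_theta_T Z).1 bZ.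
(* Y_theta; the value 0 where theta is infinite concerns a null set only. *)
pose Yt w := if theta w is Some n then Y n w else 0.
have YtE : process_ae_eq P (from_time theta Yt) (proj_between theta theta Y).
  apply: filterS theta_finite => w fin t.
  rewrite /from_time /proj_between indic_bool /Yt mulrC.
  case: (theta w) fin => [n|]// _ /=; have [nt //|_] := leqP n t.
  by rewrite !mul0r.
have bYt : Rinfty P F (from_time theta Yt).
  apply: Rinfty_ae_eq YtE _.
  have thth : \forall w \ae P, le_natinf (theta w) (theta w).
    by apply: aeW => w; case: (theta w) => //=.
  apply: (proj1 ((Rinfty_betweenP F_filtration theta theta _
    theta_stopping theta_stopping thth).1 _)).
  by exists Y => //; apply: aeW.
have projE : process_ae_eq P (proj_between theta (fun=> T) X)
    (add_process Z (from_time theta Yt)).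
  apply: filterS3 (filterI XYZ YtE) (filterI sY theta_le_T) sZ.
  move=> w [XYZ' YtE'] [sY' thT] sZ' t.
  rewrite /add_process YtE' /proj_between !indic_bool XYZ' /add_process.
  rewrite mulrDr addrC.
  have [Z0' ->] := sZ' t; congr (_ + _).
    case: (boolP (le_natinf _ _)) Z0' => /= _ Z0'; first by rewrite mul1r.
    by rewrite mul0r Z0'.
  rewrite -(sY' (min_nat_natinf t T)).2; congr (_ * Y _ w).
  by case: (theta w) T thT => [n|] [k|] //= nk; lia.
have Uge : \forall w \ae P, Yt w <= U X w.
  have bZY : Rinfty_between P F theta (fun=> T)
      (add_process Z (from_time theta Yt)).
    by apply: Rinfty_between_add => //; apply: Rinfty_between_from_time.
  apply: filterS3 Z0 (U_ae_eq _ _ projE bZY) (U_translation _ _ bZ bYt).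
  by move=> w Z0 -> ->; rewrite lerDr.
apply: filterS3 (filterI XYZ Uge) (filterI sY sZ) theta_finite.
move=> w [XYZ' Uge'] [sY' sZ'] fin t.
rewrite /settled /add_process /before_time /from_time !indic_bool /lt_natinf.
case: (boolP (le_natinf (theta w) (Some t))) => /= tht.
  rewrite andbF mulr0 add0r mulr1 -(sY' t).2; apply: le_trans Uge'.
  rewrite /Yt; case: (theta w) fin tht => [n|]//= _ nt.
  by rewrite (minn_idPr nt).
rewrite andbT mulr0 addr0 XYZ' /add_process (sZ' t).1// addr0.
have [Y0 _] := sY' t.
by case: (boolP (le_natinf (tau w) _)) Y0 => /= _ Y0; rewrite ?mulr1// mulr0 Y0.
Qed.

Lemma settled_translation X m : Rinfty_between P F tau (fun=> T) X ->
  Rinfty P F (from_time tau m) ->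
  process_ae_eq P (W (add_process X (from_time tau m)))
                  (add_process (W X) (from_time tau m)).
Proof.
move=> bX bm; have bpX := Rinfty_between_proj X (Rinfty_tau_T X bX).
have mE : process_ae_eq P (from_time theta m)
    (proj_between theta (fun=> T) (from_time tau m)).
  apply: filterS2 tau_le_theta theta_le_T => w tt thT t.
  rewrite /from_time /proj_between !indic_bool mulrCA -natrM mulnb.
  congr (_ * (nat_of_bool _)%:R).
  by case: (tau w) (theta w) T tt thT => [i|] [j|] [k|] //=; lia.
have bmt : Rinfty P F (from_time theta m).
  apply: Rinfty_ae_eq mE _.
  exact: (proj1 ((RP_theta_T _).1 (Rinfty_between_proj _ bm))).
have projE : process_ae_eq P
    (proj_between theta (fun=> T) (add_process X (from_time tau m)))
    (add_process (proj_between theta (fun=> T) X) (from_time theta m)).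
  apply: filterS mE => w mE t.
  by rewrite /add_process mE /proj_between mulrDr.
have bsum : Rinfty_between P F theta (fun=> T)
    (add_process (proj_between theta (fun=> T) X) (from_time theta m)).
  by apply: Rinfty_between_add => //; apply: Rinfty_between_from_time.
apply: filterS3 (U_ae_eq _ _ projE bsum) (U_translation _ _ bpX bmt)
  tau_le_theta.
move=> w UE tr tt t; rewrite tr in UE.
rewrite /settled /add_process /before_time /from_time /= in UE *.
rewrite UE !indic_bool /lt_natinf.
case: (boolP (le_natinf (theta w) (Some t))) => /= tht.
  rewrite !andbF !mulr0 !add0r !mulr1 (_ : le_natinf _ _) ?mulr1//.
  by move: tt tht; case: (tau w) (theta w) => [i|] [j|] //=; lia.
rewrite !andbT !mulr0 !addr0 mulrDl -mulrA -natrM mulnb andbb //.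
Qed.

Lemma time_consistencyP :
  (forall X, Rinfty_between P F tau (fun=> T) X -> V X = V (W X) %[ae P]) <->
  Ctau_T = sum_sets P Ctau_theta Ctheta_T.
Proof.
split=> [tc|CE].
  apply/seteqP; split=> X.
    move=> /acc_tau_T[bX V0]; have [D aD XE] := settled_remainder X bX.
    exists (W X), D; split=> //; apply/acc_tau_theta; split.
      exact: Rinfty_between_settled.
    by apply: filterS2 V0 (tc X bX) => w V0 /(_ I) <-.
  move=> [Y [Z [aY aZ XE]]]; have [bY V0] := (acc_tau_theta Y).1 aY.
  have bX : Rinfty_between P F tau (fun=> T) X.
    apply: Rinfty_between_ae_eq XE _; apply: Rinfty_between_add => //.
      exact: Rinfty_between_widen_end.
    by apply: Rinfty_between_widen_start; case/acc_theta_T: aZ.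
  apply/acc_tau_T; split=> //.
  apply: filterS3 V0 (tc X bX) (V_monotone Y (W X)
    (Rinfty_between_widen_end _ bY)
    (Rinfty_between_widen_end _ (Rinfty_between_settled X bX))
    (settled_ge X Y Z bY aZ XE)).
  by move=> w V0 /(_ I) ->; exact: le_trans.
move=> X bX; have bW := Rinfty_between_settled X bX.
have bWT := Rinfty_between_widen_end _ bW.
have bN Y : Rinfty_between P F tau (fun=> T) Y ->
    Rinfty P F (from_time tau (fun w => - V Y w)).
  by move=> bY; rewrite from_time_opp; apply: Rinfty_opp => //; exact: V_Rinfty.
have VleW : \forall w \ae P, V X w <= V (W X) w.
  (* X - V(X) 1_[tau,oo) is accepted, hence splits as Y + Z, and Y is dominated
     by W(X - V(X) 1_[tau,oo)) = W(X) - V(X) 1_[tau,oo). *)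
  have bXm : Rinfty_between P F tau (fun=> T)
      (add_process X (from_time tau (fun w => - V X w))).
    apply: Rinfty_between_add => //.
    by apply: Rinfty_between_from_time => //; exact: bN.
  have : Ctau_T (add_process X (from_time tau (fun w => - V X w))).
    apply/acc_tau_T; split=> //.
    by apply: filterS (V_translation _ _ bX (bN X bX)) => w ->; rewrite subrr.
  rewrite CE => -[Y [Z [/acc_tau_theta[bY V0] aZ XE]]].
  have leY := V_monotone Y _ (Rinfty_between_widen_end _ bY)
    (Rinfty_between_widen_end _ (Rinfty_between_settled _ bXm))
    (settled_ge _ Y Z bY aZ XE).
  have bWm : Rinfty_between P F tau (fun=> T)
      (add_process (W X) (from_time tau (fun w => - V X w))).
    apply: Rinfty_between_add => //.
    by apply: Rinfty_between_from_time => //; exact: bN.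
  have WE := V_ae_eq _ _ (settled_translation X _ bX (bN X bX)) bWm.
  apply: filterS3 (filterI V0 leY) WE (V_translation _ _ bWT (bN X bX)).
  move=> w [V0' leY'] WE tr; rewrite WE tr in leY'.
  by rewrite -subr_ge0; apply: le_trans leY'.
have WleV : \forall w \ae P, V (W X) w <= V X w.
  (* X - V(W(X)) 1_[tau,oo) is the sum of W(X) - V(W(X)) 1_[tau,oo), accepted
     at tau, and D = X - W(X), accepted at theta. *)
  have [D aD XE] := settled_remainder X bX.
  have : Ctau_T (add_process X (from_time tau (fun w => - V (W X) w))).
    rewrite CE; exists (add_process (W X)
      (from_time tau (fun w => - V (W X) w))), D; split=> //.
      apply/acc_tau_theta; split.
        apply: Rinfty_between_add => //.
        by apply: Rinfty_between_from_time => //; exact: bN.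
      apply: filterS (V_translation _ _ bWT (bN _ bWT)) => w ->.
      by rewrite subrr.
    by apply: filterS XE => w XE t; rewrite /add_process XE /add_process addrAC.
  move=> /acc_tau_T[_]; apply: filterS2 (V_translation _ _ bX (bN _ bWT)).
  by move=> w ->; rewrite subr_ge0.
by apply: filterS2 VleW WleV => w le1 le2 _; apply/eqP; rewrite eq_le le1.
Qed.

End Decomposition.

Theorem proposition4p6 (d : measure_display) (Omega : measurableType d)
    (R : realType) (P : probability Omega R)
    (F : nat -> set (set Omega)) (F_filtration : filtration F)
    (F_trivial : F 0%N = [set set0; [set: Omega]])
    (S : nat) (T : natinf) (tau theta : Omega -> natinf)
    (tau_stopping : stopping_time F tau)
    (theta_stopping : stopping_time F theta)
    (tau_finite : \forall w \ae P, tau w <> None)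
    (theta_finite : \forall w \ae P, theta w <> None)
    (S_le_tau : \forall w \ae P, le_natinf (Some S) (tau w))
    (tau_le_theta : \forall w \ae P, le_natinf (tau w) (theta w))
    (theta_le_T : \forall w \ae P, le_natinf (theta w) T)
    (phi : nat -> process Omega R -> Omega -> R)
    (phi_muf : muf_process P F S T phi) :
  let C := acceptance_set_process P F T phi in
  (forall X, Rinfty_between P F tau (fun=> T) X ->
     muf_at S T phi tau X =
     muf_at S T phi tau
       (add_process (before_time tau theta X)
          (from_time theta (muf_at S T phi theta
             (proj_between theta (fun=> T) X))))
     %[ae P])
  <->
  acceptance_set_at P F S T C tau (fun=> T) =
  sum_sets P (acceptance_set_at P F S T C tau theta)
             (acceptance_set_at P F S T C theta (fun=> T)).
Proof.
exact: (time_consistencyP F_filtration phi_muf tau_stopping theta_stopping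
  tau_finite theta_finite S_le_tau tau_le_theta theta_le_T).
Qed.
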